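(* Let $G$ be a finite group, let $I$ and $\Lambda$ be finite (non-empty) index sets, and let $P=(p_{\lambda i})$ be a regular $\Lambda\times I$ matrix with entries in $G^0$ that contains at least one zero entry. Then the following statements are equivalent: (1) The commuting graph $\mathcal{G}(\mathcal{M}_0[G;I,\Lambda;P])$ is connected. (2) The graph $\mathcal{G}(I,\Lambda,P)$ is connected. (3) $\overline{P}$ is not $\leftrightarrow$-equivalent to any matrix of one of the following three forms, where $A$ and $B$ are (non-empty) submatrices of $P$: the matrix $\begin{bmatrix}\overline{A}\\ \times\cdots\times\end{bmatrix}$ obtained from $\overline{A}$ by adding one row all of whose entries are $\times$; the matrix obtained from $\overline{A}$ by adding one column all of whose entries are $\times$; the block matrix $\begin{bmatrix}\overline{A} & X\\ Y&\overline{B}\end{bmatrix}$ in which all the entries of the blocks $X$ and $Y$ are $\times$. (4) For all $i\in I$ and $\lambda\in\Lambda$ such that $p_{\lambda i}=0$, the $0$-closure $(\lambda,i)$-submatrix of $P$ is $P$. (5) There exist $i\in I$ and $\lambda\in\Lambda$ such that $p_{\lambda i}=0$ and the $0$-closure $(\lambda,i)$-submatrix of $P$ is $P$.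
   Context: $G^0=G\cup\{0\}$ is $G$ with a zero adjoined. A matrix over $G^0$ is regular if every row and every column contains a non-zero entry. The $0$-Rees matrix semigroup $\mathcal{M}_0[G;I,\Lambda;P]$ is the set $(I\times G\times\Lambda)\cup\{0\}$ with $(i,x,\lambda)(j,y,\mu)=(i,xp_{\lambda j}y,\mu)$ if $p_{\lambda j}\neq 0$, $(i,x,\lambda)(j,y,\mu)=0$ if $p_{\lambda j}=0$, and all products involving $0$ equal to $0$. The commuting graph $\mathcal{G}(S)$ of a finite non-commutative semigroup $S$ is the simple graph with vertex set $S\setminus Z(S)$ ($Z(S)$ the center), where distinct $x,y$ are adjacent iff $xy=yx$. (When $P$ is regular and has a zero entry, $\mathcal{M}_0[G;I,\Lambda;P]$ is non-commutative with center $\{0\}$.) $\mathcal{G}(I,\Lambda,P)$ is the simple graph with vertex set $I\times\Lambda$ where distinct vertices $(i,\lambda),(j,\mu)$ are adjacent iff $p_{\lambda j}=p_{\mu i}=0$. $\overline{P}$ is the matrix obtained from $P$ by replacing each non-zero entry by the symbol $\times$ (zero entries are kept). Two matrices are $\leftrightarrow$-equivalent if one is obtained from the other by permuting rows and/or columns. For $I'\subseteq I$, $\Lambda'\subseteq\Lambda$, $P[\Lambda'|I']$ is the submatrix of $P$ with rows indexed by $\Lambda'$ and columns by $I'$. $0$-closure method: let $p_{\lambda i}=0$. Put $I_0=\{i\}$, $\Lambda_0=\{\lambda\}$ and, for $k\ge 0$, $I_{k+1}=I_k\cup\{j\in I: p_{\mu j}=0\text{ for some }\mu\in\Lambda_k\}$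 and $\Lambda_{k+1}=\Lambda_k\cup\{\mu\in\Lambda: p_{\mu j}=0\text{ for some }j\in I_k\}$. Let $\zeta(\lambda,i)$ be the least $k$ with $I_{k+1}=I_k$ and $\Lambda_{k+1}=\Lambda_k$. The $0$-closure $(\lambda,i)$-submatrix of $P$ is $P[\Lambda_k|I_k]$ with $k=\zeta(\lambda,i)$; it ''is $P$'' when its index sets are $I$ and $\Lambda$. *)

(* Defs.v *)
From mathcomp Require Import all_boot all_fingroup matrix.

Set Implicit Arguments.
Unset Strict Implicit.
Unset Printing Implicit Defensive.

(* A zero is adjoined to a type through [option]: [None] is the zero. Thus
   [G^0] is [option gT], and the symbols {0, x} of the pattern matrices are the
   elements of [option unit], with [Some tt] for the cross. *)

Record sgraph := SGraph {
  vertex :> finType;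
  adj : rel vertex;
  adj_sym : symmetric adj;
  adj_irr : irreflexive adj }.

Definition graph_connected (g : sgraph) : Prop :=
  forall x y : g, connect (@adj g) x y.

(* Not an HB structure: joining [Semigroup] and [Finite] is rejected, because
   [FinStarMonoid] is already declared above that missing join. *)
Record finSemigroup := FinSemigroup {
  carrier :> finType;
  smul : carrier -> carrier -> carrier;
  smulA : associative smul }.

Section CommutingGraph.
Variable S : finSemigroup.

Definition semigroup_center : {set S} :=
  [set x : S | [forall y : S, smul x y == smul y x]].

Definition noncentral : finType := {x : S | x \notin semigroup_center}.

Definition commuting_adj : rel noncentral :=
  fun x y => (x != y) && (smul (val x) (val y) == smul (val y) (val x)).

Lemma commuting_adj_sym : symmetric commuting_adj.
Proof. by move=> x y; rewrite /commuting_adj eq_sym [X in _ && X]eq_sym. Qed.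

Lemma commuting_adj_irr : irreflexive commuting_adj.
Proof. by move=> x; rewrite /commuting_adj eqxx. Qed.

Definition commuting_graph : sgraph := SGraph commuting_adj_sym commuting_adj_irr.

End CommutingGraph.

Section ReesSemigroup.
Variables (gT : finGroupType) (I Lam : finType) (P : Lam -> I -> option gT).
Local Open Scope group_scope.

Definition regular_matrix : Prop :=
  (forall l, exists i, P l i <> None) /\ (forall i, exists l, P l i <> None).

Definition rees0_mul (a b : option (I * gT * Lam)) : option (I * gT * Lam) :=
  match a, b with
  | Some (i, x, l), Some (j, y, m) =>
      if P l j is Some p then Some (i, x * p * y, m) else None
  | _, _ => None
  end.

Lemma rees0_mulA : associative rees0_mul.
Proof.
move=> [[[i x] l]|] [[[j y] m]|] [[[k z] n]|] //=; last by case: (P l j).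
by case Emk: (P m k) => [q|]; case Elj: (P l j) => [p|];
  rewrite /= ?Elj ?Emk ?mulgA.
Qed.

Definition rees0 : finSemigroup := FinSemigroup rees0_mulA.

Definition zero_adj : rel (I * Lam) :=
  fun a b => [&& a != b, P a.2 b.1 == None & P b.2 a.1 == None].

Lemma zero_adj_sym : symmetric zero_adj.
Proof. by move=> a b; rewrite /zero_adj eq_sym [X in _ && X]andbC. Qed.

Lemma zero_adj_irr : irreflexive zero_adj.
Proof. by move=> a; rewrite /zero_adj eqxx. Qed.

Definition zero_graph : sgraph := SGraph zero_adj_sym zero_adj_irr.

(* [P[L|J]], its rows and columns being listed in the order in which [L] and
   [J] are enumerated; [P] itself is [submatrix [set: Lam] [set: I]]. *)
Definition submatrix (L : {set Lam}) (J : {set I}) : 'M[option gT]_(#|L|, #|J|) :=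
  \matrix_(r < #|L|, c < #|J|) P (enum_val r) (enum_val c).

End ReesSemigroup.

Definition cross : option unit := Some tt.

Definition pattern (T : Type) m n (A : 'M[option T]_(m, n)) : 'M[option unit]_(m, n) :=
  map_mx (omap (fun=> tt)) A.

Definition perm_equiv (T : Type) m n m' n' (M : 'M[T]_(m, n)) (N : 'M[T]_(m', n')) : Prop :=
  exists (em : m' = m) (en : n' = n) (s : 'S_m) (t : 'S_n),
    M = row_perm s (col_perm t (castmx (em, en) N)).

Section Forms.
Variables (gT : finGroupType) (I Lam : finType) (P : Lam -> I -> option gT).

Definition full_pattern := pattern (submatrix P [set: Lam] [set: I]).

Definition cross_row_form : Prop :=
  exists (L : {set Lam}) (J : {set I}),
    [/\ L != set0, J != set0
      & perm_equiv full_pattern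
          (col_mx (pattern (submatrix P L J)) (const_mx cross : 'M_(1, #|J|)))].

Definition cross_col_form : Prop :=
  exists (L : {set Lam}) (J : {set I}),
    [/\ L != set0, J != set0
      & perm_equiv full_pattern
          (row_mx (pattern (submatrix P L J)) (const_mx cross : 'M_(#|L|, 1)))].

Definition cross_block_form : Prop :=
  exists (L L' : {set Lam}) (J J' : {set I}),
    [/\ L != set0, J != set0, L' != set0, J' != set0
      & perm_equiv full_pattern
          (block_mx (pattern (submatrix P L J)) (const_mx cross)
                    (const_mx cross) (pattern (submatrix P L' J')))].

End Forms.

Section ZeroClosure.
Variables (gT : finGroupType) (I Lam : finType) (P : Lam -> I -> option gT).
Variables (l : Lam) (i : I).

Fixpoint zclosure_step (k : nat) : {set I} * {set Lam} :=
  if k is k'.+1 then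
    let: (J, L) := zclosure_step k' in
    (J :|: [set j | [exists (m | m \in L), P m j == None]],
     L :|: [set m | [exists (j | j \in J), P m j == None]])
  else ([set i], [set l]).

Definition zclosure_stable (k : nat) : bool :=
  zclosure_step k.+1 == zclosure_step k.

Lemma zclosure_stable_ex : exists k, zclosure_stable k.
Proof.
pose w k := #|(zclosure_step k).1| + #|(zclosure_step k).2|.
suff H k : (exists k', zclosure_stable k') \/ k <= w k.
  case: (H (#|I| + #|Lam|).+1) => // /leq_trans/(_ (leq_add (max_card _) (max_card _))).
  by rewrite ltnn.
elim: k => [|k [IH|IH]]; [by right | by left |].
case E: (zclosure_stable k); first by left; exists k.
right; apply: leq_ltn_trans IH _; move: E.
rewrite /zclosure_stable /w /=; case: (zclosure_step k) => J L /=.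
set J' := J :|: _; set L' := L :|: _ => E.
have sJ : J \subset J' by apply: subsetUl.
have sL : L \subset L' by apply: subsetUl.
rewrite ltn_neqAle leq_add ?subset_leq_card // andbT.
apply/eqP => e; move/negP: E; apply; rewrite -pair_eqE /=.
have := subset_leq_card sJ; have := subset_leq_card sL => cL cJ.
rewrite eq_sym eqEcard sJ /= [L' == _]eq_sym eqEcard sL /=.
by apply/andP; split; [rewrite -(leq_add2r #|L'|) -e leq_add2l
                      | rewrite -(leq_add2l #|J'|) -e leq_add2r].
Qed.

Definition zeta : nat := ex_minn zclosure_stable_ex.

(* The closure submatrix is determined by its two index sets. *)
Definition zclosure : {set I} * {set Lam} := zclosure_step zeta.

Definition zclosure_is_whole : Prop :=
  zclosure.1 = [set: I] /\ zclosure.2 = [set: Lam].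

End ZeroClosure.

(* Main.v *)
Require Import Defs.
From mathcomp Require Import all_boot all_fingroup matrix.

(** Let [B] be the bipartite graph on [I + Lam] with an edge [j -- m] for each
    zero entry [P m j]. An edge of [zero_graph P] moves both coordinates of
    [(i, l)] along edges of [B] at once, swapping their sides. Hence a union of
    connected components of [B], or an isolated vertex of [B], yields a closed
    set of vertices of [zero_graph P] (forms of (3)), and conversely the
    [0]-closure explores the [B]-component of a zero entry: when it is
    everything, all pairs [(j, m)] are reached. In the semigroup, two non-zero
    elements either multiply to zero on both sides or have the same indices, so
    its commuting graph projects onto [zero_graph P]. *)

Set Implicit Arguments.
Unset Strict Implicit.
Unset Printing Implicit Defensive.

(** * Connectedness under maps and closed sets of vertices *)

Lemma connect_homo (T U : finType) (e : rel T) (e' : rel U) (h : T -> U) :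
  (forall x y, e x y -> connect e' (h x) (h y)) ->
  forall x y, connect e x y -> connect e' (h x) (h y).
Proof.
move=> he x _ /connectP[p pth ->]; elim: p x pth => [|z p IH] x /=.
  by rewrite connect0.
by case/andP=> /he xz /IH; apply: connect_trans.
Qed.

Lemma graph_connected_closed (g : sgraph) (a : pred g) x y :
  graph_connected g -> (forall u v, adj u v -> a u -> a v) -> a x -> a y.
Proof.
move=> gconn acl ax; case/connectP: (gconn x y) => p pth ->.
elim: p x ax pth => //= z p IH x ax /andP[xz]; apply: IH; exact: acl xz ax.
Qed.

Section Rees.
Variables (gT : finGroupType) (I Lam : finType) (P : Lam -> I -> option gT).

Lemma zero_connect i l j m :
  P l j = None -> P m i = None -> connect (@adj (zero_graph P)) (i, l) (j, m).
Proof.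
move=> Plj Pmi; have [->|ne] := eqVneq (i, l) (j, m); first exact: connect0.
by apply: connect1; rewrite /= /zero_adj ne Plj Pmi.
Qed.

(** If row [l] had no zero, [(i0, l)] would be an isolated vertex, and connectedness would identify
    it with [(i0, l0)], whose row does contain a zero. *)
Lemma zero_graph_row l0 i0 :
  P l0 i0 = None -> graph_connected (zero_graph P) ->
  forall l, exists j, P l j = None.
Proof.
move=> P0 gconn l; have [/existsP[j /eqP Plj]|nz] := boolP [exists j, P l j == None].
  by exists j.
suff : pred1 (i0, l) (i0, l0) by case/eqP=> <-; exists i0.
apply: (@graph_connected_closed (zero_graph P) (pred1 (i0, l)) (i0, l)) (eqxx _) => //= x [j m].
case/and3P=> _ Pj _ /eqP ex; case/existsP: nz; exists j; by rewrite ex in Pj.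
Qed.

Lemma zero_graph_col l0 i0 :
  P l0 i0 = None -> graph_connected (zero_graph P) ->
  forall i, exists m, P m i = None.
Proof.
move=> P0 gconn i; have [/existsP[m /eqP Pmi]|nz] := boolP [exists m, P m i == None].
  by exists m.
suff : pred1 (i, l0) (i0, l0) by case/eqP=> <-; exists l0.
apply: (@graph_connected_closed (zero_graph P) (pred1 (i, l0)) (i, l0)) (eqxx _) => //= x [j m].
case/and3P=> _ _ Pm /eqP ex; case/existsP: nz; exists m; by rewrite ex in Pm.
Qed.

(** * The commuting graph and its projection onto [zero_graph P] *)

Lemma rees0_commuteP i x l j y m :
  rees0_mul P (Some (i, x, l)) (Some (j, y, m)) =
  rees0_mul P (Some (j, y, m)) (Some (i, x, l)) ->
  (i, l) = (j, m) \/ P l j = None /\ P m i = None.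
Proof.
rewrite /=; case: (P l j) => [p|]; case: (P m i) => [q|] //; last by right.
by case=> -> _ ->; left.
Qed.

Lemma rees0_central0 : (None : rees0 P) \in semigroup_center (rees0 P).
Proof. by rewrite inE; apply/forallP; case=> [[[]]|]. Qed.

Lemma rees0_noncentral l0 i0 (v : option (I * gT * Lam)) :
  regular_matrix P -> P l0 i0 = None -> v <> None ->
  (v : rees0 P) \notin semigroup_center (rees0 P).
Proof.
move=> [Prow Pcol] P0; case: v => [[[i x] l]|] // _; apply/negP; rewrite inE.
move/forallP=> central.
have comm j m : (i, l) = (j, m) \/ P l j = None /\ P m i = None.
  exact/rees0_commuteP/eqP/(central (Some (j, 1%g, m))).
have [j Plj] := Prow l; have [m Pmi] := Pcol i.
(* Each tested pair contains a [j] or an [m] taken from a non-zero entry, which excludes two zero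
   products and leaves equality of the indices. *)
have l0E : l0 = l by case: (comm j l0) => [[]|[]].
have i0E : i0 = i by case: (comm i0 m) => [[]|[]].
have ijE : i = j by case: (comm j l) => [[]|[]].
by apply: Plj; rewrite -ijE -l0E -i0E.
Qed.

Lemma commute_connect (u v : noncentral (rees0 P)) :
  smul (val u) (val v) = smul (val v) (val u) ->
  connect (@adj (commuting_graph (rees0 P))) u v.
Proof.
move=> uv; have [->|ne] := eqVneq u v; first exact: connect0.
by apply: connect1; rewrite /= /commuting_adj ne uv eqxx.
Qed.

Lemma commuting_zero_connected l0 i0 :
  regular_matrix P -> P l0 i0 = None ->
  graph_connected (commuting_graph (rees0 P)) -> graph_connected (zero_graph P).
Proof.
move=> Preg P0 gconn.
(* The [else] value is a dummy: the zero of [rees0 P] is central, hence not a vertex. *)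
pose h (v : commuting_graph (rees0 P)) : zero_graph P :=
  if val (v : noncentral _) is Some (i, x, l) then (i, l) else (i0, l0).
(* Distinct commuting elements may share their indices and collapse to one vertex, so an edge is
   only sent to a path, possibly of length zero. *)
have hadj u v : adj u v -> connect (@adj (zero_graph P)) (h u) (h v).
  rewrite /h; case: u v => [[[[i x] l]|] nu] [[[[j y] m]|] nv] /=;
    try by [case/negP: nu; exact: rees0_central0
           |case/negP: nv; exact: rees0_central0].
  case/andP=> _ /eqP /rees0_commuteP [->|[Plj Pmi]]; first exact: connect0.
  exact: zero_connect.
have hsurj p : exists u, h u = p.
  case: p => i l.
  have nc : (Some (i, 1%g, l) : rees0 P) \notin semigroup_center (rees0 P).
    exact: (rees0_noncentral Preg P0).
  by exists (exist _ (Some (i, 1%g, l) : rees0 P) nc).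
move=> p q; have [u <-] := hsurj p; have [v <-] := hsurj q.
exact: connect_homo hadj _ _ (gconn u v).
Qed.

(** The elements with group coordinate [1] carry the paths of [zero_graph P]. Every vertex
    [(i, x, l)] commutes with some [(j, 1, m)], because row [l] and column [i] both contain a
    zero. *)
Lemma zero_commuting_connected l0 i0 :
  regular_matrix P -> P l0 i0 = None ->
  graph_connected (zero_graph P) -> graph_connected (commuting_graph (rees0 P)).
Proof.
move=> Preg P0 gconn.
pose over (p : I * Lam) : option (I * gT * Lam) := Some (p.1, 1%g, p.2).
have nc p : (over p : rees0 P) \notin semigroup_center (rees0 P).
  exact: (rees0_noncentral Preg P0).
pose w (p : zero_graph P) : commuting_graph (rees0 P) := exist _ (over p : rees0 P) (nc p).
have wadj p q : adj p q -> connect (@adj (commuting_graph (rees0 P))) (w p) (w q).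
  case: p q => [i l] [j m] /and3P[_ /eqP /= Plj /eqP /= Pmi].
  by apply: commute_connect; rewrite /= Plj Pmi.
have uw u : exists p, connect (@adj (commuting_graph (rees0 P))) u (w p).
  case: u => [[[[i x] l]|] nu]; last by case/negP: nu; exact: rees0_central0.
  have [j Plj] := zero_graph_row P0 gconn l.
  have [m Pmi] := zero_graph_col P0 gconn i.
  by exists (j, m); apply: commute_connect; rewrite /= Plj Pmi.
have csym : connect_sym (@adj (commuting_graph (rees0 P))).
  exact/sym_connect_sym/adj_sym.
move=> u v; have [p up] := uw u; have [q vq] := uw v.
apply: connect_trans up _; rewrite csym; apply: connect_trans vq _.
exact: connect_homo wadj _ _ (gconn q p).
Qed.

(** * Permutation equivalence as a labelling of rows and columns *)

(** Permutations, casts and [enum_val] compose to bijections onto [Lam] and [I], so that the three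
    forms can be handled without dimension casts. *)
Lemma perm_equiv_fullP m' n' (N : 'M[option unit]_(m', n')) :
  perm_equiv (full_pattern P) N <->
  exists (f : 'I_m' -> Lam) (g : 'I_n' -> I), [/\ bijective f, bijective g
    & forall r c, N r c = omap (fun=> tt) (P (f r) (g c))].
Proof.
split=> [[em [en [s [t E]]]]|[f [g [fbij gbij E]]]].
  (* Row [r] of the permuted matrix is row [s r] of [N] up to the cast, whence the inverse
     permutations. *)
  exists (fun r => enum_val ((s^-1)%g (cast_ord em r))).
  exists (fun c => enum_val ((t^-1)%g (cast_ord en c))).
  have ebij (T : finType) k (ek : k = #|[set: T]|) (u : 'S_#|[set: T]|) :
      bijective (fun r => @enum_val T [set: T] ((u^-1)%g (cast_ord ek r))).
    apply: inj_card_bij; last by rewrite card_ord ek cardsT.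
    exact/(inj_comp (@enum_val_inj _ _))/(inj_comp perm_inj)/cast_ord_inj.
  split=> // r c.
  move/matrixP/(_ ((s^-1)%g (cast_ord em r)) ((t^-1)%g (cast_ord en c))): E.
  by rewrite !mxE castmxE !permKV !cast_ordK.
case: fbij gbij => f' fK f'K [g' gK g'K].
have em : m' = #|[set: Lam]|.
  by rewrite cardsT -(bij_eq_card (Bijective fK f'K)) card_ord.
have en : n' = #|[set: I]|.
  by rewrite cardsT -(bij_eq_card (Bijective gK g'K)) card_ord.
have sinj : injective (fun r => cast_ord em (f' (@enum_val _ [set: Lam] r))).
  exact/(inj_comp (@cast_ord_inj _ _ _))/(inj_comp (can_inj f'K))/enum_val_inj.
have tinj : injective (fun c => cast_ord en (g' (@enum_val _ [set: I] c))).
  exact/(inj_comp (@cast_ord_inj _ _ _))/(inj_comp (can_inj g'K))/enum_val_inj.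
exists em, en, (perm sinj), (perm tinj); apply/matrixP=> r c.
by rewrite !mxE castmxE !permE !cast_ordK E f'K g'K.
Qed.

(** The two blocks have disjoint images, so the labelling is injective, and counting makes it
    bijective. *)
Lemma enum_split_bij (T : finType) (A : {set T}) n (h : 'I_n -> T) :
  injective h -> (forall b, h b \notin A) -> #|A| + n = #|T| ->
  bijective (fun r : 'I_(#|A| + n) =>
               match split r with inl a => enum_val a | inr b => h b end).
Proof.
move=> hinj hA card; apply: inj_card_bij; last by rewrite card_ord card.
move=> r r' /=; case: (split_ordP r) => a ->; case: (split_ordP r') => b -> e.
- by rewrite (enum_val_inj e).
- by case/negP: (hA b); rewrite -e enum_valP.
- by case/negP: (hA a); rewrite e enum_valP.
- by rewrite (hinj _ _ e).
Qed.

Lemma cross_entry l i : cross = omap (fun=> tt) (P l i) -> P l i <> None.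
Proof. by case: (P l i). Qed.

Lemma entry_cross l i : P l i <> None -> cross = omap (fun=> tt) (P l i).
Proof. by case: (P l i). Qed.

(** * Connectedness of [zero_graph P] excludes the three forms *)

Lemma zero_graph_not_cross_row l0 i0 :
  P l0 i0 = None -> graph_connected (zero_graph P) -> ~ cross_row_form P.
Proof.
move=> P0 gconn [L [J [_ _ /perm_equiv_fullP[f [g [_ [g' _ g'K] E]]]]]].
have [j Pj] := zero_graph_row P0 gconn (f (rshift _ ord0)).
have := E (rshift _ ord0) (g' j); rewrite col_mxEd mxE => /cross_entry.
by rewrite g'K.
Qed.

Lemma zero_graph_not_cross_col l0 i0 :
  P l0 i0 = None -> graph_connected (zero_graph P) -> ~ cross_col_form P.
Proof.
move=> P0 gconn [L [J [_ _ /perm_equiv_fullP[f [g [[f' _ f'K] _ E]]]]]].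
have [m Pm] := zero_graph_col P0 gconn (g (rshift _ ord0)).
have := E (f' m) (rshift _ ord0); rewrite row_mxEr mxE => /cross_entry.
by rewrite f'K.
Qed.

(** All zeros lie in the diagonal blocks, so the row and the column of a zero are on the same side.
    Along an edge the two sides are exchanged, so the vertices with both coordinates in the first
    block form a closed set. *)
Lemma zero_graph_not_cross_block :
  graph_connected (zero_graph P) -> ~ cross_block_form P.
Proof.
move=> gconn [L [L' [J [J' [L0 J0 L'0 _]]]]].
case/perm_equiv_fullP=> f [g [[f' fK f'K] [g' gK g'K] E]].
pose left m n (k : 'I_(m + n)) := if split k is inl _ then true else false.
have leftl m n (k : 'I_m) : left m n (lshift n k).
  by rewrite /left (unsplitK (inl k)).
have leftr m n (k : 'I_n) : left m n (rshift m k) = false.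
  by rewrite /left (unsplitK (inr k)).
have zleft l i : P l i = None -> left _ _ (f' l) = left _ _ (g' i).
  rewrite -{1}(f'K l) -{1}(g'K i); move: (f' l) (g' i) => r c.
  case: (split_ordP r) => a ->; case: (split_ordP c) => b ->;
    rewrite ?leftl ?leftr // => Z.
    by have := E (lshift _ a) (rshift _ b); rewrite block_mxEur mxE => /cross_entry.
  by have := E (rshift _ a) (lshift _ b); rewrite block_mxEdl mxE => /cross_entry.
have [l Ll] := set0Pn _ L0; have [i Ji] := set0Pn _ J0; have [m Lm] := set0Pn _ L'0.
pose a (p : zero_graph P) := left _ _ (g' p.1) && left _ _ (f' p.2).
(* This vertex mixes a column of the first block with a row of the second, so [a] fails there. *)
suff : a (g (lshift _ (enum_rank_in Ji i)), f (rshift _ (enum_rank_in Lm m))).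
  by rewrite /a /= gK fK leftl leftr.
apply: (@graph_connected_closed (zero_graph P) a
  (g (lshift _ (enum_rank_in Ji i)), f (lshift _ (enum_rank_in Ll l))) _ gconn).
  move=> [j1 l1] [j2 l2] /and3P[_ /eqP /zleft /= e1 /eqP /zleft /= e2].
  by rewrite /a /= -e1 e2 andbC.
by rewrite /a /= gK fK !leftl.
Qed.

(** * Building the three forms from sets of rows and columns *)

Lemma cross_row_formI m :
  (exists l, l != m) -> 0 < #|I| -> (forall j, P m j <> None) -> cross_row_form P.
Proof.
move=> [l lm] /card_gt0P[i _] Pm; exists [set~ m], [set: I]; split.
- by apply/set0Pn; exists l; rewrite !inE.
- by apply/set0Pn; exists i; rewrite inE.
apply/perm_equiv_fullP.
exists (fun r => match split r with inl a => enum_val a | inr _ => m end), enum_val.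
split=> [||r c].
- apply: (enum_split_bij (h := fun _ : 'I_1 => m)).
  + by move=> x y _; rewrite !ord1.
  + by move=> _; rewrite !inE eqxx.
  + by rewrite -(cardsC [set~ m]) setCK cards1.
- by apply: inj_card_bij (@enum_val_inj _ _) _; rewrite card_ord cardsT.
- case: (split_ordP r) => a ->; first by rewrite col_mxEu !mxE.
  by rewrite col_mxEd mxE; exact: entry_cross.
Qed.

Lemma cross_col_formI j :
  (exists i, i != j) -> 0 < #|Lam| -> (forall m, P m j <> None) -> cross_col_form P.
Proof.
move=> [i ij] /card_gt0P[l _] Pj; exists [set: Lam], [set~ j]; split.
- by apply/set0Pn; exists l; rewrite inE.
- by apply/set0Pn; exists i; rewrite !inE.
apply/perm_equiv_fullP.
exists enum_val, (fun c => match split c with inl a => enum_val a | inr _ => j end).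
split=> [||r c].
- by apply: inj_card_bij (@enum_val_inj _ _) _; rewrite card_ord cardsT.
- apply: (enum_split_bij (h := fun _ : 'I_1 => j)).
  + by move=> x y _; rewrite !ord1.
  + by move=> _; rewrite !inE eqxx.
  + by rewrite -(cardsC [set~ j]) setCK cards1.
- case: (split_ordP c) => a ->; first by rewrite row_mxEl !mxE.
  by rewrite row_mxEr mxE; exact: entry_cross.
Qed.

(** [L] and [J] together are a union of components of the bipartite graph of zeros, so the
    off-diagonal blocks cut out by the complements contain no zero. *)
Lemma cross_block_formI (L : {set Lam}) (J : {set I}) :
  L != set0 -> J != set0 -> L != setT -> J != setT ->
  (forall m j, P m j = None -> (m \in L) = (j \in J)) -> cross_block_form P.
Proof.
move=> L0 J0 LT JT PLJ; exists L, (~: L), J, (~: J).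
have C0 (T : finType) (A : {set T}) : A != setT -> ~: A != set0.
  by apply: contraNneq => A0; rewrite -[A]setCK A0 setC0.
split; rewrite ?C0 //.
apply/perm_equiv_fullP.
exists (fun r => match split r with inl a => enum_val a | inr b => enum_val b end).
exists (fun r => match split r with inl a => enum_val a | inr b => enum_val b end).
have ebij (T : finType) (A : {set T}) : bijective (fun r : 'I_(#|A| + #|~: A|) =>
    match split r with inl a => enum_val a | inr b => enum_val b end).
  apply: (enum_split_bij (@enum_val_inj _ _)) (cardsC A) => b.
  by have := enum_valP b; rewrite inE.
split=> // r c.
case: (split_ordP r) => a ->; case: (split_ordP c) => b ->.
- by rewrite block_mxEul !mxE.
- rewrite block_mxEur mxE; apply: entry_cross => /PLJ; rewrite enum_valP.
  by have := enum_valP b; rewrite inE => /negbTE->.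
- rewrite block_mxEdl mxE; apply: entry_cross => /PLJ; rewrite enum_valP.
  by have := enum_valP a; rewrite inE => /negbTE->.
- by rewrite block_mxEdr !mxE.
Qed.

(** * The [0]-closure *)

Lemma mem_zclosure_step l i k :
  i \in (zclosure_step P l i k).1 /\ l \in (zclosure_step P l i k).2.
Proof.
elim: k => [|k] /=; first by rewrite !inE.
by case: (zclosure_step P l i k) => J L /= [iJ lL]; rewrite !inE iJ lL.
Qed.

(** The step [zeta] is stable: if one index of a zero entry is in the closure, a further step would
    add the other, so it is already there. *)
Lemma zclosure_closed l i m j :
  P m j = None -> (m \in (zclosure P l i).2) = (j \in (zclosure P l i).1).
Proof.
move=> Pmj; rewrite /zclosure /zeta; case: ex_minnP => k /eqP /= + _.
case: (zclosure_step P l i k) => J L /= [EJ EL].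
apply/idP/idP => [mL|jJ]; [rewrite -EJ|rewrite -EL]; rewrite !inE;
  apply/orP; right; apply/existsP; [exists m|exists j]; by rewrite ?mL ?jJ Pmj.
Qed.

(** If only the row set of the closure is proper, a row outside it has no zero; likewise for
    columns. If both sets are proper, they and their complements give the block form. *)
Lemma no_form_zclosure l i :
  0 < #|I| -> 0 < #|Lam| -> P l i = None ->
  ~ cross_row_form P -> ~ cross_col_form P -> ~ cross_block_form P ->
  zclosure_is_whole P l i.
Proof.
move=> I0 Lam0 P0 nrow ncol nblock; rewrite /zclosure_is_whole.
have [iJ lL] : i \in (zclosure P l i).1 /\ l \in (zclosure P l i).2.
  exact: mem_zclosure_step.
have := @zclosure_closed l i; case: (zclosure P l i) iJ lL => J L /= iJ lL clos.
have nsetT (T : finType) (A : {set T}) : A != setT -> exists x, x \notin A.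
  by rewrite -subTset => /subsetPn[x _]; exists x.
have [JT|JT] := eqVneq J setT; have [LT|LT] := eqVneq L setT => //.
- have [m mL] := nsetT _ _ LT; case: nrow; apply: (@cross_row_formI m) => //.
    by exists l; apply: contraNneq mL => <-.
  by move=> j /clos; rewrite (negbTE mL) JT inE.
- have [j jJ] := nsetT _ _ JT; case: ncol; apply: (@cross_col_formI j) => //.
    by exists i; apply: contraNneq jJ => <-.
  by move=> m /clos; rewrite (negbTE jJ) LT inE.
- case: nblock; apply: (@cross_block_formI L J) => //; apply/set0Pn.
    by exists l.
  by exists i.
Qed.

(* The first two conjuncts let an index already present at step [k] be reached
   like a new one, so that each step is a single move in [zero_graph P]. *)
Lemma zclosure_step_connect l i k :
  P l i = None ->
  let: (J, L) := zclosure_step P l i k in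
  [/\ {in J, forall j, exists2 m, m \in L & P m j = None},
      {in L, forall m, exists2 j, j \in J & P m j = None}
    & forall j m, j \in J -> m \in L ->
        connect (@adj (zero_graph P)) (i, l) (j, m)].
Proof.
move=> P0; elim: k => [|k] /=.
  split=> [j|m|j m]; rewrite !inE.
  - by move/eqP->; exists l; rewrite ?inE.
  - by move/eqP->; exists i; rewrite ?inE.
  - by move=> /eqP-> /eqP->; exact: connect0.
case: (zclosure_step P l i k) => J L /= [JP LP conn].
set J' := J :|: _; set L' := L :|: _.
have J'P : {in J', forall j, exists2 m, m \in L & P m j = None}.
  move=> j; rewrite !inE => /orP[/JP //|/existsP[m /andP[mL /eqP Pmj]]].
  by exists m.
have L'P : {in L', forall m, exists2 j, j \in J & P m j = None}.
  move=> m; rewrite !inE => /orP[/LP //|/existsP[j /andP[jJ /eqP Pmj]]].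
  by exists j.
split=> [j /J'P[m mL Pmj]|m /L'P[j jJ Pmj]|j m /J'P[m' mL Pm'j] /L'P[j' jJ Pmj']].
- by exists m; rewrite // inE mL.
- by exists j; rewrite // inE jJ.
(* The zeros in row [m'] at [j] and in column [j'] at [m] make a single move from the earlier pair
   [(j', m')] reach both new indices. *)
- exact: connect_trans (conn _ _ jJ mL) (zero_connect Pm'j Pmj').
Qed.

Lemma zclosure_zero_connected l i :
  P l i = None -> zclosure_is_whole P l i -> graph_connected (zero_graph P).
Proof.
move=> P0; rewrite /zclosure_is_whole /zclosure.
have := zclosure_step_connect (zeta P l i) P0.
case: (zclosure_step _ _ _ _) => J L [_ _ conn] /= [JT LT].
have all_conn (p : zero_graph P) : connect (@adj (zero_graph P)) (i, l) p.
  by case: p => j m; apply: conn; rewrite ?JT ?LT inE.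
have csym : connect_sym (@adj (zero_graph P)).
  exact/sym_connect_sym/adj_sym.
by move=> p q; apply: connect_trans (all_conn q); rewrite csym.
Qed.

End Rees.

Theorem theorem4p14 (gT : finGroupType) (I Lam : finType)
    (P : Lam -> I -> option gT)
    (I_nonempty : (0 < #|I|)%N) (Lam_nonempty : (0 < #|Lam|)%N)
    (P_regular : regular_matrix P)
    (P_zero : exists l i, P l i = None) :
  [<-> graph_connected (commuting_graph (rees0 P));
       graph_connected (zero_graph P);
       [/\ ~ cross_row_form P, ~ cross_col_form P & ~ cross_block_form P];
       (forall (i : I) (l : Lam), P l i = None -> zclosure_is_whole P l i);
       (exists (i : I) (l : Lam), P l i = None /\ zclosure_is_whole P l i)].
Proof.
have [l0 [i0 P0]] := P_zero; tfae.
- exact: (commuting_zero_connected P_regular P0).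
- move=> gconn; split.
  + exact: (zero_graph_not_cross_row P0).
  + exact: (zero_graph_not_cross_col P0).
  + exact: zero_graph_not_cross_block.
- by case=> nrow ncol nblock i l Pli; apply: no_form_zclosure.
- by move=> whole; exists i0, l0; split=> //; apply: whole.
(* The cycle of implications closes through connectedness of [zero_graph P]. *)
- case=> i [l [Pli whole]]; apply: (zero_commuting_connected P_regular Pli).
  exact: zclosure_zero_connected whole.
Qed.
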